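(* Consider a nearest-neighbor mixture process (NNMP) $\{Z(\boldsymbol v):\boldsymbol v\in\mathcal D\}$ with reference set $\mathcal S=\{\boldsymbol s_1,\dots,\boldsymbol s_n\}$, weights $w_l(\boldsymbol v)$ and component densities $f_{\boldsymbol v,l}$, where, for every $\boldsymbol v\in\mathcal D$ and $l=1,\dots,L$, the component density $f_{\boldsymbol v,l}(u\mid v)$ is the conditional density of $U_{\boldsymbol v,l}$ given $V_{\boldsymbol v,l}=v$, for a random vector $(U_{\boldsymbol v,l},V_{\boldsymbol v,l})$ following a bivariate distribution with marginal densities $f_{U_{\boldsymbol v,l}}$ and $f_{V_{\boldsymbol v,l}}$. Let $f_Z$ be a probability density. Suppose that $Z(\boldsymbol s_1)\sim f_Z$ and that, for every $\boldsymbol v\in\mathcal D$, $f_Z(z)=f_{U_{\boldsymbol v,l}}(z)=f_{V_{\boldsymbol v,l}}(z)$ for all $z$ and all $l$. Then the NNMP has stationary marginal density $f_Z$; that is, $Z(\boldsymbol v)$ has density $f_Z$ for every $\boldsymbol v\in\mathcal D$.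
   Context: Nearest-neighbor mixture process (NNMP). Let $\mathcal D\subset\mathbb R^p$, $p\ge 1$, and let $\mathcal S=\{\boldsymbol s_1,\dots,\boldsymbol s_n\}\subset\mathcal D$ be a finite ordered set of distinct locations (the reference set). Let $L\le n$ be a positive integer. Densities are with respect to a fixed dominating measure on the state space $\mathcal X\subseteq\mathbb R$ (e.g. Lebesgue measure in the continuous case). Neighbor sets: for $\boldsymbol v=\boldsymbol s_i\in\mathcal S$ with $i\ge2$, $\mathrm{Ne}(\boldsymbol s_i)\subset\{\boldsymbol s_1,\dots,\boldsymbol s_{i-1}\}$ consists of the $i_L:=\min(i-1,L)$ locations closest to $\boldsymbol s_i$, denoted in ascending order of distance $\boldsymbol s_{(i1)},\dots,\boldsymbol s_{(i,i_L)}$. For $\boldsymbol v\in\mathcal D\setminus\mathcal S$, $\mathrm{Ne}(\boldsymbol v)\subset\mathcal S$ consists of the $L$ locations of $\mathcal S$ closest to $\boldsymbol v$. In general the elements of $\mathrm{Ne}(\boldsymbol v)$ are written $\boldsymbol v_{(1)},\boldsymbol v_{(2)},\dots$ in ascending order of distance, and $\boldsymbol z_{\mathrm{Ne}(\boldsymbol v)}$ is the vector of values $z(\boldsymbol v_{(l)})$. Conditional densities: for each $\boldsymbol v\in\mathcal D$, $\boldsymbol v\ne\boldsymbol s_1$, $$p(z(\boldsymbol v)\mid\boldsymbol z_{\mathrm{Ne}(\boldsymbol v)})=\sum_{l=1}^{L}w_l(\boldsymbol v)\,f_{\boldsymbol v,l}(z(\boldsymbol v)\mid z(\boldsymbol v_{(l)})),$$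 with $w_l(\boldsymbol v)\ge0$ and $\sum_l w_l(\boldsymbol v)=1$ (for $\boldsymbol v=\boldsymbol s_i\in\mathcal S$ the sum runs over $l=1,\dots,i_L$). Finite-dimensional distributions: the joint density over $\mathcal S$ is $\tilde p(\boldsymbol z_{\mathcal S})=p(z(\boldsymbol s_1))\prod_{i=2}^n p(z(\boldsymbol s_i)\mid\boldsymbol z_{\mathrm{Ne}(\boldsymbol s_i)})$; for a finite set $\mathcal U=\{\boldsymbol u_1,\dots,\boldsymbol u_r\}\subset\mathcal D\setminus\mathcal S$, $\tilde p(\boldsymbol z_{\mathcal U}\mid\boldsymbol z_{\mathcal S})=\prod_{i=1}^r p(z(\boldsymbol u_i)\mid\boldsymbol z_{\mathrm{Ne}(\boldsymbol u_i)})$; and for an arbitrary finite $\mathcal V\subset\mathcal D$ the joint density of $(Z(\boldsymbol v))_{\boldsymbol v\in\mathcal V}$ is obtained from $\tilde p(\boldsymbol z_{\mathcal U}\mid\boldsymbol z_{\mathcal S})\,\tilde p(\boldsymbol z_{\mathcal S})$ with $\mathcal U=\mathcal V\setminus\mathcal S$ by integrating out $z(\boldsymbol s_i)$ for $\boldsymbol s_i\in\mathcal S\setminus\mathcal V$. *)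

(* Defs.v *)
From HB Require Import structures.
From mathcomp Require Export all_boot all_order all_algebra.
From mathcomp Require Export all_classical all_reals all_analysis.

Set Implicit Arguments.
Unset Strict Implicit.
Unset Printing Implicit Defensive.

Import Order.TTheory GRing.Theory Num.Theory.

Local Open Scope classical_set_scope.
Local Open Scope ring_scope.

Section Densities.
Context (R : realType) (mu : {sigma_finite_measure set R -> \bar R}).
Context (X : set R).

(* The state space is the set X; values of densities outside X are irrelevant. *)
Definition is_pdf (g : R -> R) : Prop :=
  [/\ measurable_fun X g, (forall z, X z -> 0 <= g z)
    & (\int[mu]_(z in X) (g z)%:E = 1)%E].

Definition has_pdf d (T : measurableType d) (P : probability T R)
    (Y : {RV P >-> R}) (g : R -> R) : Prop :=
  is_pdf g /\
  forall A : set R, measurable A ->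
    P (Y @^-1` A) = (\int[mu]_(z in A `&` X) (g z)%:E)%E.

(* [f u y] stands for f(u | y). *)
Definition is_cond_pdf (f : R -> R -> R) : Prop :=
  measurable_fun (X `*` X) (fun uy : R * R => f uy.1 uy.2) /\
  forall y, X y -> is_pdf (f ^~ y).

(* f is a version of the conditional density of U given V, where V has density
   fV: the joint law of (U, V) has density f(u | y) fV(y). *)
Definition has_cond_pdf d (T : measurableType d) (P : probability T R)
    (U V : {RV P >-> R}) (fV : R -> R) (f : R -> R -> R) : Prop :=
  is_cond_pdf f /\
  forall A B : set R, measurable A -> measurable B ->
    P (U @^-1` A `&` V @^-1` B) =
    (\int[mu]_(y in B `&` X) \int[mu]_(u in A `&` X) (f u y * fV y)%:E)%E.

(* Integral of F over X in each of the coordinates listed in r (without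
   repetition), the other coordinates being frozen at their values in z. *)
Fixpoint integrate_out (I : eqType) (r : seq I) (F : (I -> R) -> \bar R)
    (z : I -> R) : \bar R :=
  if r is i :: r' then
    (\int[mu]_(t in X) integrate_out r' F [eta z with i |-> t])%E
  else F z.

End Densities.

Section Neighbors.
Context (R : realType) (p n : nat).
Implicit Types (x y v : 'rV[R]_p) (s : 'I_n.+1 -> 'rV[R]_p).

(* The canonical norm of 'rV[R]_p is the sup norm, hence this definition. *)
Definition edist x y : R := Num.sqrt (\sum_(j < p) (x 0 j - y 0 j) ^+ 2).

(* N lists (the indices of) k nearest neighbors of v among the s j with
   [C j], in ascending order of distance; ties are broken arbitrarily. *)
Definition nearest_neighbors s (C : pred 'I_n.+1) (k : nat) v
    (N : seq 'I_n.+1) : Prop :=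
  [/\ size N = k, uniq N, {subset N <= C},
      sorted (fun i j => edist v (s i) <= edist v (s j)) N
    & forall i j, i \in N -> C j -> j \notin N ->
        edist v (s i) <= edist v (s j)].

End Neighbors.

Section NNMP.
Context (R : realType) (mu : {sigma_finite_measure set R -> \bar R}).
Context (X : set R) (p n L : nat) (D : set 'rV[R]_p).
(* The reference set is s ord0, ..., s ord_max (n.+1 locations). *)
Context (s : 'I_n.+1 -> 'rV[R]_p).
(* Neighbors always belong to the reference set: Ne v lists their indices. *)
Context (Ne : 'rV[R]_p -> seq 'I_n.+1).
Context (w : 'rV[R]_p -> 'I_L -> R) (f : 'rV[R]_p -> 'I_L -> R -> R -> R).
Context (p1 : R -> R).
Implicit Types (v : 'rV[R]_p) (z : 'rV[R]_p -> R).

Definition ngh v (l : 'I_L) : 'rV[R]_p := s (nth ord0 (Ne v) l).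

(* p(z(v) | z_Ne(v)); a configuration z assigns a value to every location, but
   only z v and the values at the neighbors of v matter. *)
Definition mix_pdf v z : R :=
  \sum_(l < L | (l < size (Ne v))%N) w v l * f v l (z v) (z (ngh v l)).

Definition ref_pdf z : R :=
  p1 (z (s ord0)) * \prod_(i < n.+1 | i != ord0) mix_pdf (s i) z.

Definition nonref_pdf (U : seq 'rV[R]_p) z : R := \prod_(u <- U) mix_pdf u z.

Definition fd_pdf (V : seq 'rV[R]_p) z : \bar R :=
  integrate_out mu X [seq v <- codom s | v \notin V]
    (fun z => (nonref_pdf [seq v <- V | v \notin codom s] z * ref_pdf z)%:E) z.

Record is_nnmp d (T : measurableType d) (P : probability T R)
    (Z : 'rV[R]_p -> {RV P >-> R}) : Prop := {
  nnmp_ref_inj : injective s;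
  nnmp_ref_dom : forall i, D (s i);
  nnmp_ngh_ref : forall i : 'I_n.+1,
    nearest_neighbors s (fun j => (j < i)%N) (minn i L) (s i) (Ne (s i));
  nnmp_ngh_nonref : forall v, D v -> v \notin codom s ->
    nearest_neighbors s xpredT L v (Ne v);
  nnmp_weight_ge0 : forall v (l : 'I_L), D v -> v != s ord0 ->
    (l < size (Ne v))%N -> 0 <= w v l;
  nnmp_weight_sum : forall v, D v -> v != s ord0 ->
    \sum_(l < L | (l < size (Ne v))%N) w v l = 1;
  nnmp_component : forall v (l : 'I_L), D v -> v != s ord0 ->
    (l < size (Ne v))%N -> is_cond_pdf mu X (f v l);
  nnmp_init : is_pdf mu X p1;
  (* For distinct V_0, ..., V_(k-1) in D, the law of (Z V_0, ..., Z V_(k-1))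
     has density fd_pdf V with respect to the k-fold product of mu on X.  All
     coordinates on which the integrand depends are integrated, so the initial
     configuration fun=> 0 plays no role. *)
  nnmp_fdd : forall k (V : k.-tuple 'rV[R]_p), uniq V ->
    (forall j, D (tnth V j)) ->
    forall B : set (k.-tuple R), measurable B ->
      P [set o | B [tuple Z (tnth V j) o | j < k]] =
      integrate_out mu X V
        (fun z => ((\1_B [tuple z (tnth V j) | j < k])%:E * fd_pdf V z)%E)
        (fun=> 0)
}.

End NNMP.

(* Main.v *)
(* The finite-dimensional density at the whole reference set, possibly followed
   by one more location, is the product of p1 and of the conditional densities,
   with nothing to integrate out, and every location comes after its neighbors.
   Integrating the last location out replaces its conditional density by 1, or,
   if the observable H is a function of that location, replaces H(z(v)) by the
   mixture over l of (K_l H)(z(v_(l))), where K_l H(y) is the integral of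
   H(u) f_{v,l}(u | y).  Since f_Z is both marginals of (U_{v,l}, V_{v,l}), the
   kernel K_l preserves integrals against f_Z, so by induction on the number of
   locations every coordinate has density f_Z. *)
Require Import Defs.
From mathcomp Require Import measurable_realfun.

Set Implicit Arguments.
Unset Strict Implicit.
Unset Printing Implicit Defensive.

Import Order.TTheory GRing.Theory Num.Theory.

Local Open Scope classical_set_scope.
Local Open Scope ring_scope.

(** * Measure-theoretic preliminaries *)

Section Tonelli.
Context d1 d2 (T1 : measurableType d1) (T2 : measurableType d2) (R : realType).
Context (m1 : {sigma_finite_measure set T1 -> \bar R}).
Context (m2 : {sigma_finite_measure set T2 -> \bar R}).
Context (D1 : set T1) (D2 : set T2).
Hypotheses (mD1 : measurable D1) (mD2 : measurable D2).
Context (f : T1 * T2 -> \bar R).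
Hypothesis mf : measurable_fun (D1 `*` D2) f.
Hypothesis f0 : forall x y, D1 x -> D2 y -> (0 <= f (x, y))%E.

(** Extension by zero makes [f] measurable and nonnegative on the whole product, where Tonelli's
    theorem applies, and preserves the integrals of sections over [D1] and [D2]. *)
Let g := f \_ (D1 `*` D2).

Let mg : measurable_fun setT g.
Proof.
apply/(measurable_restrict _ (measurableX mD1 mD2) measurableT).
by rewrite setTI.
Qed.

Let g0 x : (0 <= g x)%E.
Proof.
rewrite /g /patch; case: ifPn => // /set_mem; case: x => x y [] /=.
exact: f0.
Qed.

Let gE1 x : D1 x -> (\int[m2]_(y in D2) f (x, y) = \int[m2]_y g (x, y))%E.
Proof.
move=> Dx; rewrite integral_mkcond; apply: eq_integral => y _.
rewrite /g /patch; congr (if _ then _ else _).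
by apply/idP/idP => /set_mem h; apply/mem_set; [split|case: h].
Qed.

Let gE2 y : D2 y -> (\int[m1]_(x in D1) f (x, y) = \int[m1]_x g (x, y))%E.
Proof.
move=> Dy; rewrite integral_mkcond; apply: eq_integral => x _.
rewrite /g /patch; congr (if _ then _ else _).
by apply/idP/idP => /set_mem h; apply/mem_set; [split|case: h].
Qed.

Lemma measurable_fun_section_integral :
  measurable_fun D1 (fun x => \int[m2]_(y in D2) f (x, y))%E.
Proof.
apply: (eq_measurable_fun (fubini_F m2 g)).
  by move=> x /set_mem Dx; rewrite gE1.
exact/measurable_funTS/measurable_fun_fubini_tonelli_F.
Qed.

Lemma setX_tonelli :
  (\int[m1]_(x in D1) \int[m2]_(y in D2) f (x, y) =
   \int[m2]_(y in D2) \int[m1]_(x in D1) f (x, y))%E.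
Proof.
transitivity (\int[m1]_x \int[m2]_y g (x, y))%E.
  rewrite integral_mkcond; apply: eq_integral => x _.
  rewrite /patch; case: ifPn => [/set_mem /gE1 //|/negP nD].
  rewrite integral0_eq// => y _; rewrite /g /patch ifF//.
  by apply/negP => /set_mem [D _]; apply/nD/mem_set.
rewrite fubini_tonelli// [RHS]integral_mkcond; apply: eq_integral => y _.
rewrite /patch; case: ifPn => [/set_mem /gE2 //|/negP nD].
rewrite integral0_eq// => x _; rewrite /g /patch ifF//.
by apply/negP => /set_mem [_ D]; apply/nD/mem_set.
Qed.

End Tonelli.

(** * Finite sums over a filtered index, as they occur in the mixtures *)

Section FilteredSums.
Context d (T : measurableType d) (R : realType) (D : set T).
Context (I : Type) (s : seq I) (c : pred I).

Lemma measurable_fun_sum_cond (h : I -> T -> R) :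
  (forall i, c i -> measurable_fun D (h i)) ->
  measurable_fun D (fun x => \sum_(i <- s | c i) h i x).
Proof.
move=> mh; under eq_fun do rewrite big_mkcond.
by apply: measurable_sum => i; case ci: (c i); [exact: mh|exact: measurable_cst].
Qed.

Lemma ge0_integral_sum_cond (m : measure T R) (h : I -> T -> \bar R) :
  measurable D -> (forall i, c i -> measurable_fun D (h i)) ->
  (forall i x, c i -> D x -> (0 <= h i x)%E) ->
  (\int[m]_(x in D) \sum_(i <- s | c i) h i x =
   \sum_(i <- s | c i) \int[m]_(x in D) h i x)%E.
Proof.
move=> mD mh h0; under eq_integral => x _ do rewrite big_mkcond.
rewrite [RHS]big_mkcond ge0_integral_sum//.
- apply: eq_bigr => i _; case: (c i) => //; exact: integral0.
- by move=> i; case ci: (c i); [exact: mh|exact: measurable_cst].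
- by move=> i x Dx; case: ifPn => // ci; exact: h0.
Qed.

End FilteredSums.

(** * Iterated integrals *)

Section IteratedIntegrals.
Context (R : realType) (mu : {sigma_finite_measure set R -> \bar R}).
Context (X : set R) (mX : measurable X) (I : eqType).
Implicit Types (r : seq I) (z : I -> R) (F G : (I -> R) -> \bar R).

(** [integrate_out] recurses on the head of the list, so the last coordinate is the innermost
    integral. This form lets inductions peel off the last location, on which no earlier factor
    depends. *)
Lemma integrate_out_rcons r i F z :
  integrate_out mu X (rcons r i) F z =
  integrate_out mu X r
    (fun z => \int[mu]_(t in X) F [eta z with i |-> t])%E z.
Proof.
elim: r z => //= j r IH z; apply: eq_integral => t _; exact: IH.
Qed.

Lemma eq_integrate_out r F G z :
  (forall z, (forall i, i \in r -> X (z i)) -> F z = G z) ->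
  integrate_out mu X r F z = integrate_out mu X r G z.
Proof.
elim/last_ind: r F G => [|r i IH] F G FG; first exact: FG.
rewrite !integrate_out_rcons; apply: IH => y Xy.
apply: eq_integral => t /set_mem Xt; apply: FG => j /=.
by rewrite mem_rcons inE; case: eqP => //= _; exact: Xy.
Qed.

(* Measurability is tested along measurable families of configurations, which
   avoids a product sigma-algebra on [I -> R]. *)
Definition nnegm_on r F : Prop :=
  (forall z, (forall i, i \in r -> X (z i)) -> (0 <= F z)%E) /\
  forall d (T : measurableType d) (phi : T -> I -> R) (D : set T),
    measurable D -> (forall i, measurable_fun setT (phi^~ i)) ->
    (forall t i, D t -> i \in r -> X (phi t i)) ->
    measurable_fun D (F \o phi).

Lemma nnegm_on_section r i F z : nnegm_on (rcons r i) F ->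
  (forall j, j \in r -> X (z j)) ->
  measurable_fun X (fun t => F [eta z with i |-> t]).
Proof.
move=> [_ mF] Xz; apply: (mF _ _ (fun t => [eta z with i |-> t])) => //=.
  by move=> j; case: eqP.
by move=> t j Xt; rewrite mem_rcons inE; case: eqP => //= _; exact: Xz.
Qed.

(** Adjoining the integrated coordinate as an extra real parameter turns a family over [T] into one
    over [T * R]; Tonelli then makes the integral over that parameter measurable in [T]. *)
Lemma nnegm_on_integral r i F : nnegm_on (rcons r i) F ->
  nnegm_on r (fun z => \int[mu]_(t in X) F [eta z with i |-> t])%E.
Proof.
move=> [F0 mF]; split=> [z Xz|d T phi D mD mphi Xphi].
  apply: integral_ge0 => t Xt; apply: F0 => j /=.
  by rewrite mem_rcons inE; case: eqP => //= _; exact: Xz.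
apply: (@measurable_fun_section_integral _ _ _ _ _ mu _ _ mD mX
  (fun p => F [eta phi p.1 with i |-> p.2])).
- apply: (mF _ _ (fun p : T * R => [eta phi p.1 with i |-> p.2])).
  + exact: measurableX.
  + move=> j /=; case: eqP => _; first exact: measurable_snd.
    exact: (measurableT_comp (mphi j)).
  + move=> [t x] j [/= Dt Xx]; rewrite mem_rcons inE.
    by case: eqP => //= _; exact: Xphi.
- move=> t x Dt Xx; apply: F0 => j /=.
  by rewrite mem_rcons inE; case: eqP => //= _; exact: Xphi.
Qed.

(** Nonnegativity makes the innermost integral additive, and [nnegm_on_integral] passes the
    condition on to the next one. *)
Lemma integrate_out_sum r (J : Type) (s : seq J) (c : pred J)
    (F : J -> (I -> R) -> \bar R) z :
  (forall j, c j -> nnegm_on r (F j)) ->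
  integrate_out mu X r (fun z => \sum_(j <- s | c j) F j z)%E z =
  (\sum_(j <- s | c j) integrate_out mu X r (F j) z)%E.
Proof.
elim/last_ind: r F => [//|r i IH] F gF; rewrite integrate_out_rcons.
under [RHS]eq_bigr do rewrite integrate_out_rcons.
rewrite -IH => [|j cj]; last exact/nnegm_on_integral/gF.
apply: eq_integrate_out => y Xy; apply: ge0_integral_sum_cond => //.
  by move=> j cj; apply: nnegm_on_section Xy; exact: gF.
move=> j t cj Xt; apply: (gF j cj).1 => k /=.
by rewrite mem_rcons inE; case: eqP => //= _; exact: Xy.
Qed.

Lemma nnegm_on_coord r i (H : R -> \bar R) : i \in r ->
  measurable_fun X H -> (forall x, X x -> (0 <= H x)%E) ->
  nnegm_on r (fun z => H (z i)).
Proof.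
move=> ri mH H0; split=> [z Xz|d T phi D mD mphi Xphi].
  exact/H0/Xz.
apply: (measurable_comp mX _ mH (g := phi^~ i)).
  by move=> _ [t Dt <-]; exact: Xphi.
exact: measurable_funTS.
Qed.

Lemma nnegm_onM r F G : nnegm_on r F -> nnegm_on r G ->
  nnegm_on r (fun z => F z * G z)%E.
Proof.
move=> [F0 mF] [G0 mG]; split=> [z Xz|d T phi D mD mphi Xphi].
  by apply: mule_ge0; [exact: F0|exact: G0].
by apply: emeasurable_funM; [exact: mF|exact: mG].
Qed.

End IteratedIntegrals.
(** * Kernels preserving a density *)

Section Stationarity.
Context (R : realType) (mu : {sigma_finite_measure set R -> \bar R}).
Context (X : set R) (mX : measurable X).

(* Two densities with the same integrals over measurable sets agree almost
   everywhere, hence may be exchanged under any integral. *)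
Lemma eq_integral_pdf (g : R -> R) (q H : R -> \bar R) :
  is_pdf mu X g -> measurable_fun X q ->
  (forall E, measurable E -> E `<=` X ->
    \int[mu]_(u in E) (g u)%:E = \int[mu]_(u in E) q u)%E ->
  measurable_fun X H ->
  (\int[mu]_(u in X) (H u * (g u)%:E) = \int[mu]_(u in X) (H u * q u))%E.
Proof.
move=> [mg g0 g1] mq gq mH.
have mEg : measurable_fun X (EFin \o g) by exact/measurable_EFinP.
(* Total mass one makes [g] integrable, which is what turns equal integrals over sets into equality
   almost everywhere. *)
have gi : mu.-integrable X (EFin \o g).
  apply/integrableP; split=> //.
  under eq_integral => x /set_mem Xx do rewrite /= ger0_norm ?g0//.
  by rewrite g1 ltry.
apply: ae_eq_integral => //; try exact: emeasurable_funM.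
apply: ae_eqe_mul2l; apply: integral_ae_eq => // E EX mE.
exact: gq.
Qed.

Context (f : R -> R -> R) (hf : is_cond_pdf mu X f).
Context (H : R -> \bar R) (mH : measurable_fun X H).
Hypothesis H0 : forall x, X x -> (0 <= H x)%E.

Let f0 u y : X u -> X y -> 0 <= f u y.
Proof. by move=> Xu Xy; have [_ + _] := hf.2 y Xy; exact. Qed.

Let mfswap : measurable_fun (X `*` X) (fun p : R * R => f p.2 p.1).
Proof.
apply: (measurable_comp (measurableX mX mX) _ hf.1 (g := fun p => (p.2, p.1))).
  by move=> _ [[x y] [/= Xx Xy] <-].
exact: measurable_funTS (measurable_fun_pair measurable_snd measurable_fst).
Qed.

Let measurable_snd_on (K : R -> \bar R) : measurable_fun X K ->
  measurable_fun (X `*` X) (fun p : R * R => K p.2).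
Proof.
move=> mK; apply: (measurable_comp mX _ mK (g := snd)).
  by move=> _ [[x y] [/= Xx Xy] <-].
exact: measurable_funTS measurable_snd.
Qed.

Let measurable_fst_on (K : R -> \bar R) : measurable_fun X K ->
  measurable_fun (X `*` X) (fun p : R * R => K p.1).
Proof.
move=> mK; apply: (measurable_comp mX _ mK (g := fst)).
  by move=> _ [[x y] [/= Xx Xy] <-].
exact: measurable_funTS measurable_fst.
Qed.

Lemma measurable_kernel_integral :
  measurable_fun X (fun y => \int[mu]_(u in X) (H u * (f u y)%:E))%E.
Proof.
apply: (@measurable_fun_section_integral _ _ _ _ _ mu _ _ mX mX
  (fun p => H p.2 * (f p.2 p.1)%:E)%E).
- apply: emeasurable_funM; first exact: measurable_snd_on.
  exact/measurable_EFinP.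
- by move=> y u Xy Xu /=; rewrite mule_ge0 ?H0// lee_fin f0.
Qed.

Lemma kernel_integral_ge0 y : X y ->
  (0 <= \int[mu]_(u in X) (H u * (f u y)%:E))%E.
Proof.
by move=> Xy; apply: integral_ge0 => u Xu; rewrite mule_ge0 ?H0// lee_fin f0.
Qed.

(** The marginal in [u] of [f u y * g y] has the same integrals over sets as [g], so it may replace
    [g] against [H]; Tonelli then exchanges the two integrals. *)
Lemma kernel_stationary (g : R -> R) : is_pdf mu X g ->
  (forall A, measurable A ->
    \int[mu]_(y in X) \int[mu]_(u in A `&` X) (f u y * g y)%:E =
    \int[mu]_(u in A `&` X) (g u)%:E)%E ->
  (\int[mu]_(y in X) (\int[mu]_(u in X) (H u * (f u y)%:E) * (g y)%:E) =
   \int[mu]_(u in X) (H u * (g u)%:E))%E.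
Proof.
move=> pg stat; have [mg g0 _] := pg.
have mEg : measurable_fun X (EFin \o g) by exact/measurable_EFinP.
have mfg : measurable_fun (X `*` X) (fun p : R * R => (f p.2 p.1 * g p.1)%:E).
  apply/measurable_EFinP/measurable_funM => //.
  by apply/measurable_EFinP; exact: (measurable_fst_on mEg).
have mgf : measurable_fun (X `*` X) (fun p : R * R => (f p.1 p.2 * g p.2)%:E).
  apply/measurable_EFinP/measurable_funM; first exact: hf.1.
  by apply/measurable_EFinP; exact: (measurable_snd_on mEg).
have fg0 u y : X u -> X y -> (0 <= (f u y * g y)%:E)%E.
  by move=> Xu Xy; rewrite lee_fin mulr_ge0 ?f0 ?g0.
have mfu y : X y -> measurable_fun X (fun u => (f u y)%:E).
  by move=> Xy; apply/measurable_EFinP; have [] := hf.2 y Xy.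
rewrite (eq_integral_pdf (q := fun u => \int[mu]_(y in X) (f u y * g y)%:E)%E)//.
- transitivity (\int[mu]_(y in X) \int[mu]_(u in X)
      (H u * (f u y * g y)%:E))%E.
    apply: eq_integral => y /set_mem Xy.
    rewrite -ge0_integralZr//; last 3 first.
    + by apply: emeasurable_funM => //; exact: mfu.
    + by move=> u Xu; rewrite mule_ge0 ?H0// lee_fin f0.
    + by rewrite lee_fin g0.
    by apply: eq_integral => u _; rewrite EFinM muleA.
  rewrite (@setX_tonelli _ _ _ _ _ mu mu _ _ mX mX
      (fun p => H p.2 * (f p.2 p.1 * g p.1)%:E)%E)/=; last 2 first.
  + by apply: emeasurable_funM; [exact: measurable_snd_on|].
  + by move=> y u Xy Xu /=; rewrite mule_ge0 ?H0// fg0.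
  apply: eq_integral => u /set_mem Xu; rewrite ge0_integralZl//.
  + apply: (measurable_comp (measurableX mX mX) _ mgf (g := pair u)).
      by move=> _ [y Xy <-].
    exact: measurable_funTS (pair1_measurable u).
  + by move=> y Xy; exact: fg0.
  + exact: H0.
- apply: (@measurable_fun_section_integral _ _ _ _ _ mu _ _ mX mX
    (fun p => (f p.1 p.2 * g p.2)%:E)%E) => // u y Xu Xy; exact: fg0.
(* The hypothesis has [y] in the outer integral, hence a second use of Tonelli, now on [X] and
   [E]. *)
- move=> E mE EX; have EXE : E `&` X = E by exact/setIidl.
  have := stat E mE; rewrite EXE => <-.
  rewrite (@setX_tonelli _ _ _ _ _ mu mu _ _ mX mE
    (fun p => (f p.2 p.1 * g p.1)%:E)%E)//.
  + apply: measurable_funS mfg; first exact: measurableX.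
    by move=> [y u] [/= Xy /EX Xu].
  + by move=> y u Xy /EX Xu; exact: fg0.
Qed.

End Stationarity.
(** * Chains of mixture kernels *)

Section Chain.
Context (R : realType) (mu : {sigma_finite_measure set R -> \bar R}).
Context (X : set R) (mX : measurable X) (p n L : nat) (D : set 'rV[R]_p).
Context (s : 'I_n.+1 -> 'rV[R]_p) (Ne : 'rV[R]_p -> seq 'I_n.+1).
Context (w : 'rV[R]_p -> 'I_L -> R) (f : 'rV[R]_p -> 'I_L -> R -> R -> R).
Context (p1 : R -> R).
Hypothesis w_ge0 : forall v (l : 'I_L), D v -> v != s ord0 ->
  (l < size (Ne v))%N -> 0 <= w v l.
Hypothesis w_sum : forall v, D v -> v != s ord0 ->
  \sum_(l < L | (l < size (Ne v))%N) w v l = 1.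
Hypothesis hf : forall v l, D v -> is_cond_pdf mu X (f v l).
Hypothesis p1_pdf : is_pdf mu X p1.
Implicit Types (u v a : 'rV[R]_p) (q : seq 'rV[R]_p) (z : 'rV[R]_p -> R).

Local Notation mix := (mix_pdf s Ne w f).
Local Notation ngh := (ngh s Ne).

(** Generalizes the joint density over the reference set to a list [q] of locations after the first
    one, so that inductions can shorten the list. *)
Definition chain_pdf q z : R := p1 (z (s ord0)) * \prod_(v <- q) mix v z.

Definition can_follow q v : Prop :=
  [/\ D v, v \notin s ord0 :: q
    & forall l : 'I_L, (l < size (Ne v))%N -> ngh v l \in s ord0 :: q].

(** A topological order of the neighbor graph, stated for every splitting so that it passes to
    prefixes. *)
Definition ordered_chain r : Prop :=
  forall q v q', r = q ++ v :: q' -> can_follow q v.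

Lemma ordered_chain_rcons q v :
  ordered_chain (rcons q v) <-> ordered_chain q /\ can_follow q v.
Proof.
split=> [h|[hq hv] q1 u q2].
  split; last by apply: (h q v [::]); rewrite cats1.
  by move=> q1 u q2 qE; apply: (h _ _ (rcons q2 v)); rewrite qE rcons_cat.
case/lastP: q2 => [|q2 x].
  by rewrite cats1 => /rcons_inj [<- <-].
by rewrite -rcons_cons -rcons_cat => /rcons_inj [/hq].
Qed.

Lemma can_follow_neq0 q v : can_follow q v -> v != s ord0.
Proof. by case=> _; rewrite inE negb_or => /andP[]. Qed.

Lemma can_follow_ngh q v (l : 'I_L) :
  can_follow q v -> (l < size (Ne v))%N -> ngh v l != v.
Proof. by case=> _ nv hv /hv; apply: contraTneq => ->. Qed.

Lemma ordered_chain_mem q v : ordered_chain q -> v \in q ->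
  [/\ D v, v != s ord0
    & forall l : 'I_L, (l < size (Ne v))%N -> ngh v l \in s ord0 :: q].
Proof.
move=> + vq; case/splitPr: vq => q1 q2 /(_ _ _ _ erefl) cf.
split; [by case: cf|exact: can_follow_neq0 cf|move=> l ll].
by case: cf => _ _ /(_ l ll); rewrite !inE mem_cat => /orP[->//|->]; rewrite orbT.
Qed.

Lemma mix_pdf_update u z v t : u != v ->
  (forall l : 'I_L, (l < size (Ne u))%N -> ngh u l != v) ->
  mix u [eta z with v |-> t] = mix u z.
Proof.
move=> uv nv; apply: eq_bigr => l ll /=.
by rewrite (negbTE uv) (negbTE (nv l ll)).
Qed.

(** The factors of [q] read only coordinates in [s ord0 :: q], so a fresh coordinate [v] does not
    affect them; this lets them leave the integral over [v]. *)
Lemma chain_pdf_update q v z t : ordered_chain q -> v \notin s ord0 :: q ->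
  chain_pdf q [eta z with v |-> t] = chain_pdf q z.
Proof.
move=> oq vq; have neq u : u \in s ord0 :: q -> u != v.
  by apply: contraTneq => ->.
rewrite /chain_pdf /= (negbTE (neq _ (mem_head _ _))); congr (_ * _).
apply: eq_big_seq => u uq; have [_ _ nu] := ordered_chain_mem oq uq.
apply: mix_pdf_update; first by apply: neq; rewrite inE uq orbT.
by move=> l /nu /neq.
Qed.

Lemma nnegm_on_mix q r v : D v -> v != s ord0 -> v \in r ->
  (forall l : 'I_L, (l < size (Ne v))%N -> ngh v l \in r) ->
  nnegm_on X r (fun z => (mix v z)%:E).
Proof.
move=> Dv v0 vr nr; split=> [z Xz|d T phi E mE mphi Xphi].
  rewrite lee_fin sumr_ge0// => l ll; rewrite mulr_ge0 ?w_ge0//.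
  by have [_ + _] := (hf l Dv).2 _ (Xz _ (nr l ll)); apply; exact: Xz.
apply/measurable_EFinP/measurable_fun_sum_cond => l ll.
apply: measurable_funM => //.
apply: (measurable_comp (measurableX mX mX) _ (hf l Dv).1
  (g := fun t => (phi t v, phi t (ngh v l)))).
  by move=> _ [t Et <-]; split; apply: Xphi => //; exact: nr.
exact/measurable_funTS/measurable_fun_pair.
Qed.

Lemma nnegm_on_chain q r : ordered_chain q -> {subset s ord0 :: q <= r} ->
  nnegm_on X r (fun z => (chain_pdf q z)%:E).
Proof.
elim/last_ind: q => [|q v IH] oq qr.
  rewrite /chain_pdf.
  under eq_fun do rewrite big_nil mulr1.
  have [mp p0 _] := p1_pdf.
  apply: (nnegm_on_coord mX (H := EFin \o p1)).
  - exact/qr/mem_head.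
  - exact/measurable_EFinP.
  - by move=> x Xx; rewrite lee_fin p0.
have -> : (fun z => (chain_pdf (rcons q v) z)%:E) =
    (fun z => (chain_pdf q z)%:E * (mix v z)%:E)%E.
  by apply/funext => z; rewrite /chain_pdf big_rcons mulrA EFinM.
have [oq' _] := (ordered_chain_rcons q v).1 oq.
have vq : v \in rcons q v by rewrite mem_rcons mem_head.
have [Dv v0 nv] := ordered_chain_mem oq vq.
apply: nnegm_onM.
  apply: IH => // u; rewrite inE => uq; apply: qr.
  by rewrite inE mem_rcons inE; case/orP: uq => ->; rewrite ?orbT.
apply: nnegm_on_mix => //; first by apply: qr; rewrite inE vq orbT.
by move=> l /nv /qr.
Qed.

(** * Integration over the last location of a chain *)

Lemma integral_mix v z (H : R -> \bar R) : D v -> v != s ord0 ->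
  (forall l : 'I_L, (l < size (Ne v))%N -> ngh v l != v /\ X (z (ngh v l))) ->
  measurable_fun X H -> (forall x, X x -> (0 <= H x)%E) ->
  (\int[mu]_(t in X) (H t * (mix v [eta z with v |-> t])%:E) =
   \sum_(l < L | (l < size (Ne v))%N)
     (w v l)%:E * \int[mu]_(t in X) (H t * (f v l t (z (ngh v l)))%:E))%E.
Proof.
move=> Dv v0 nv mH H0.
have f0 (l : 'I_L) t : (l < size (Ne v))%N -> X t -> 0 <= f v l t (z (ngh v l)).
  by move=> ll; have [_ + _] := (hf l Dv).2 _ (nv l ll).2; exact.
have mHf (l : 'I_L) : (l < size (Ne v))%N ->
    measurable_fun X (fun t => H t * (f v l t (z (ngh v l)))%:E)%E.
  move=> ll; apply: emeasurable_funM => //; apply/measurable_EFinP.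
  by have [] := (hf l Dv).2 _ (nv l ll).2.
have Hf0 (l : 'I_L) t : (l < size (Ne v))%N -> X t ->
    (0 <= H t * (f v l t (z (ngh v l)))%:E)%E.
  by move=> ll Xt; rewrite mule_ge0 ?H0// lee_fin f0.
(* The neighbors differ from [v], so the conditioning value in each component stays fixed while [t]
   varies. *)
transitivity (\int[mu]_(t in X) \sum_(l < L | (l < size (Ne v))%N)
    ((w v l)%:E * (H t * (f v l t (z (ngh v l)))%:E)))%E.
  apply: eq_integral => t /set_mem Xt.
  rewrite /mix_pdf -sumEFin ge0_sume_distrr; last first.
    move=> l ll; rewrite lee_fin mulr_ge0 ?w_ge0//= eqxx.
    by rewrite (negbTE (nv l ll).1) f0.
  apply: eq_bigr => l ll /=; rewrite eqxx (negbTE (nv l ll).1).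
  by rewrite EFinM muleCA.
rewrite ge0_integral_sum_cond//.
- apply: eq_bigr => l ll; rewrite ge0_integralZl//.
  + exact: mHf.
  + by move=> t; exact: Hf0.
  + by rewrite lee_fin w_ge0.
- by move=> l ll; apply: emeasurable_funM => //; exact: mHf.
- by move=> l t ll Xt; rewrite mule_ge0 ?Hf0// lee_fin w_ge0.
Qed.

(** The case [H = 1] of the mixture formula: every component has mass one and the weights sum to
    one. *)
Lemma integral_mix1 v z : D v -> v != s ord0 ->
  (forall l : 'I_L, (l < size (Ne v))%N -> ngh v l != v /\ X (z (ngh v l))) ->
  (\int[mu]_(t in X) (mix v [eta z with v |-> t])%:E = 1)%E.
Proof.
move=> Dv v0 nv.
have := integral_mix Dv v0 nv (H := cst 1%E) (measurable_cst _) (fun _ _ => lee01).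
under eq_integral do rewrite mul1e.
move=> ->; rewrite -[RHS](congr1 EFin (w_sum Dv v0)) -sumEFin.
apply: eq_bigr => l ll; under eq_integral do rewrite mul1e.
by have [_ _ ->] := (hf l Dv).2 _ (nv l ll).2; rewrite mule1.
Qed.

Lemma integral_chain_rcons q v z (H : R -> \bar R) :
  ordered_chain (rcons q v) -> (forall u, u \in s ord0 :: q -> X (z u)) ->
  measurable_fun X H -> (forall x, X x -> (0 <= H x)%E) ->
  (\int[mu]_(t in X) (H t * (chain_pdf (rcons q v) [eta z with v |-> t])%:E) =
   \int[mu]_(t in X) (H t * (mix v [eta z with v |-> t])%:E) *
     (chain_pdf q z)%:E)%E.
Proof.
move=> /ordered_chain_rcons [oq cf] Xz mH H0.
have v0 := can_follow_neq0 cf; have [Dv vq nv] := cf.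
have c0 : (0 <= (chain_pdf q z)%:E)%E.
  by apply: (nnegm_on_chain oq (r := s ord0 :: q) _).1.
have gm : nnegm_on X (rcons (s ord0 :: q) v) (fun z => (mix v z)%:E).
  apply: nnegm_on_mix => //; first by rewrite mem_rcons mem_head.
  by move=> l /nv ?; rewrite mem_rcons inE; apply/orP; right.
rewrite -ge0_integralZr//.
- apply: eq_integral => t _; rewrite {1}/chain_pdf big_rcons.
  rewrite mulrA -/(chain_pdf q _) chain_pdf_update//.
  by rewrite mulrC EFinM muleA.
- by apply: emeasurable_funM => //; exact: nnegm_on_section gm Xz.
- move=> t Xt; rewrite mule_ge0 ?H0//; apply: gm.1 => u.
  rewrite mem_rcons inE => /predU1P[->|uq] /=; first by rewrite eqxx.
  by case: eqP => // _; exact: Xz.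
Qed.

(** As [a] differs from [v], the value of [H] is constant in the innermost integral, where the only
    factor depending on [v] is a conditional density of mass one. *)
Lemma integrate_out_last q v a z (H : R -> \bar R) :
  ordered_chain (rcons q v) -> a \in s ord0 :: q ->
  measurable_fun X H -> (forall x, X x -> (0 <= H x)%E) ->
  integrate_out mu X (s ord0 :: rcons q v)
    (fun z => H (z a) * (chain_pdf (rcons q v) z)%:E)%E z =
  integrate_out mu X (s ord0 :: q)
    (fun z => H (z a) * (chain_pdf q z)%:E)%E z.
Proof.
move=> oqv aq mH H0; rewrite -rcons_cons integrate_out_rcons.
apply: eq_integrate_out => // y Xy.
have [oq cf] := (ordered_chain_rcons q v).1 oqv.
have v0 := can_follow_neq0 cf; have [Dv vq nv] := cf.
have av : a != v by apply: contraTneq aq => ->.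
have Ha0 : (0 <= H (y a))%E by exact/H0/Xy.
rewrite /= (negbTE av).
rewrite (integral_chain_rcons (H := cst (H (y a))) oqv Xy)//.
rewrite ge0_integralZl//; last 2 first.
- have gm : nnegm_on X (rcons (s ord0 :: q) v) (fun z => (mix v z)%:E).
    apply: nnegm_on_mix => //; first by rewrite mem_rcons mem_head.
    by move=> l /nv ?; rewrite mem_rcons inE; apply/orP; right.
  exact: nnegm_on_section gm Xy.
- move=> t Xt; rewrite lee_fin sumr_ge0// => l ll; rewrite mulr_ge0 ?w_ge0//=.
  rewrite eqxx (negbTE (can_follow_ngh cf ll)).
  by have [_ + _] := (hf l Dv).2 _ (Xy _ (nv l ll)); apply.
rewrite integral_mix1 ?mule1// => l ll; split; first exact: (can_follow_ngh cf).
exact/Xy/nv.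
Qed.

(** Every location after the first disappears because conditional densities have mass one. This is
    available before [p1] is compared with the stationary density, and serves to make that
    comparison. *)
Lemma integrate_out_chain_init q z (H : R -> \bar R) : ordered_chain q ->
  measurable_fun X H -> (forall x, X x -> (0 <= H x)%E) ->
  (integrate_out mu X (s ord0 :: q)
    (fun z => H (z (s ord0)) * (chain_pdf q z)%:E) z =
  \int[mu]_(t in X) (H t * (p1 t)%:E))%E.
Proof.
elim/last_ind: q => [|q v IH] oq mH H0; last first.
  rewrite integrate_out_last ?mem_head//; apply: IH => //.
  by have [] := (ordered_chain_rcons q v).1 oq.
by apply: eq_integral => t _; rewrite /chain_pdf big_nil mulr1 /= eqxx.
Qed.

(** * Stationarity along a chain *)

Context (g : R -> R) (g_pdf : is_pdf mu X g).
Hypothesis f_stat : forall v l, D v -> forall A, measurable A ->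
  (\int[mu]_(y in X) \int[mu]_(u in A `&` X) (f v l u y * g y)%:E =
   \int[mu]_(u in A `&` X) (g u)%:E)%E.
(** [p1] is matched with [g] only under integrals, since a law determines its density only almost
    everywhere. *)
Hypothesis init_stat : forall H : R -> \bar R, measurable_fun X H ->
  (\int[mu]_(t in X) (H t * (p1 t)%:E) = \int[mu]_(t in X) (H t * (g t)%:E))%E.

(** The induction is over arbitrary observables, not just indicators: integrating out the last
    location [v] turns [H] at [v] into weighted functions [K l] at its neighbors, to which the
    induction hypothesis applies. *)
Lemma integrate_out_chain_stationary q a z (H : R -> \bar R) :
  ordered_chain q -> a \in s ord0 :: q ->
  measurable_fun X H -> (forall x, X x -> (0 <= H x)%E) ->
  (integrate_out mu X (s ord0 :: q)
    (fun z => H (z a) * (chain_pdf q z)%:E) z =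
   \int[mu]_(t in X) (H t * (g t)%:E))%E.
Proof.
elim/last_ind: q a H => [|q v IH] a H oqv.
  rewrite inE => /eqP -> mH H0.
  by rewrite integrate_out_chain_init// init_stat.
have [oq cf] := (ordered_chain_rcons q v).1 oqv.
rewrite -rcons_cons mem_rcons inE => /predU1P[->|aq] mH H0; last first.
  by rewrite rcons_cons integrate_out_last//; exact: IH.
have v0 := can_follow_neq0 cf; have [Dv vq nv] := cf.
(* [K l y] is the conditional expectation of [H] under component [l], given the value [y] at the
   corresponding neighbor. *)
pose K l y := (\int[mu]_(t in X) (H t * (f v l t y)%:E))%E.
have mK l : measurable_fun X (K l).
  by apply: measurable_kernel_integral => //; exact: hf.
have K0 l y : X y -> (0 <= K l y)%E.
  by move=> Xy; apply: (kernel_integral_ge0 (hf l Dv)).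
have wK0 (l : 'I_L) y : (l < size (Ne v))%N -> X y ->
    (0 <= (w v l)%:E * K l y)%E.
  by move=> ll Xy; rewrite mule_ge0 ?K0// lee_fin w_ge0.
rewrite integrate_out_rcons.
transitivity (integrate_out mu X (s ord0 :: q) (fun z =>
    \sum_(l < L | (l < size (Ne v))%N)
      ((w v l)%:E * K l (z (ngh v l))) * (chain_pdf q z)%:E)%E z).
  apply: eq_integrate_out => // y Xy /=; rewrite eqxx.
  rewrite (integral_chain_rcons oqv Xy)// integral_mix//; last first.
    by move=> l ll; split; [exact: (can_follow_ngh cf)|exact/Xy/nv].
  by rewrite ge0_sume_distrl// => l ll; apply: wK0 => //; exact/Xy/nv.
rewrite integrate_out_sum//; last first.
  move=> l ll; apply: nnegm_onM; last exact: nnegm_on_chain.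
  apply: (nnegm_on_coord mX (H := fun y => (w v l)%:E * K l y)%E) => //.
  - exact: nv.
  - exact: emeasurable_funM.
  - by move=> y; exact: wK0.
(* Writing the factor 1 as the sum of the weights reduces the claim to one component at a time. *)
rewrite -[RHS]mul1e -[1%E](congr1 EFin (w_sum Dv v0)) -sumEFin.
rewrite ge0_sume_distrl; last by move=> l ll; rewrite lee_fin w_ge0.
apply: eq_bigr => l ll.
rewrite (IH _ (fun y => (w v l)%:E * K l y)%E) ?nv//; last 2 first.
- exact: emeasurable_funM.
- by move=> y; exact: wK0.
rewrite -(kernel_stationary mX (hf l Dv) mH H0 g_pdf (f_stat l Dv)).
under eq_integral do rewrite -muleA.
have [mg g0 _] := g_pdf.
rewrite ge0_integralZl//.
- by apply: emeasurable_funM => //; exact/measurable_EFinP.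
- by move=> y Xy; rewrite mule_ge0 ?K0// lee_fin g0.
- by rewrite lee_fin w_ge0.
Qed.

End Chain.
(** * The process on its reference set *)

Lemma integral_indicM d (T : measurableType d) (R : realType)
    (m : measure T R) (A D : set T) (f : T -> \bar R) :
  (\int[m]_(x in D) ((\1_A x)%:E * f x) = \int[m]_(x in A `&` D) f x)%E.
Proof.
rewrite setIC integral_mkcondr; apply: eq_integral => x _.
by rewrite epatch_indic muleC.
Qed.

Section ReferenceChain.
Context (R : realType) (mu : {sigma_finite_measure set R -> \bar R}).
Context (X : set R) (p n L : nat) (D : set 'rV[R]_p).
Context (s : 'I_n.+1 -> 'rV[R]_p) (Ne : 'rV[R]_p -> seq 'I_n.+1).
Context (w : 'rV[R]_p -> 'I_L -> R) (f : 'rV[R]_p -> 'I_L -> R -> R -> R).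
Context (p1 : R -> R).
Context d (T : measurableType d) (P : probability T R).
Context (Z : 'rV[R]_p -> {RV P >-> R}).
Hypothesis hZ : is_nnmp mu X D s Ne w f p1 Z.

Definition ref_tail : seq 'rV[R]_p := [seq s (lift ord0 i) | i <- enum 'I_n].

Lemma codom_ref : codom s = s ord0 :: ref_tail.
Proof. by rewrite codomE enum_ordSl /= -map_comp. Qed.

Lemma ref_pdf_chain z : ref_pdf s Ne w f p1 z = chain_pdf s Ne w f p1 ref_tail z.
Proof.
rewrite /ref_pdf /chain_pdf; congr (_ * _).
rewrite big_mkcond big_ord_recl /= mul1r /ref_tail big_map big_enum /=.
by apply: eq_bigr.
Qed.

(** Neighbors of a reference location have smaller indices, hence lie in the prefix before it. *)
Lemma ordered_chain_ref : ordered_chain L D s Ne ref_tail.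
Proof.
move=> q v q' rE.
have us : uniq (codom s) by apply/injectiveP; exact: (nnmp_ref_inj hZ).
have cE : codom s = (s ord0 :: q) ++ v :: q' by rewrite codom_ref rE.
have nthE (j : 'I_n.+1) : nth v (codom s) j = s j.
  by rewrite codomE (nth_map ord0) ?size_enum_ord// nth_ord_enum.
(* The index of [v] is [(size q).+1] rather than [size q], because [q] starts after [s ord0]. *)
have sz : ((size q).+1 < n.+1)%N.
  have := congr1 size cE; rewrite size_codom card_ord size_cat /= addnS => ->.
  by rewrite ltnS leq_addr.
pose j := Ordinal sz.
have vj : v = s j by rewrite -nthE cE nth_cat /= ltnn subnn.
split.
- rewrite vj; exact: (nnmp_ref_dom hZ).
- move: us; rewrite cE cat_uniq => /and3P[_ + _]; apply: contra => vq.
  by apply/hasP; exists v => //; exact: mem_head.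
- move=> l ll; have [_ _ Nej _ _] := nnmp_ngh_ref hZ j.
  set k := nth ord0 (Ne v) l.
  have kj : (k < j)%N by apply: Nej; rewrite -vj; exact: mem_nth.
  rewrite /ngh -/k -nthE cE nth_cat /= kj; exact: mem_nth.
Qed.

(** All neighbors are reference locations, so a location outside the reference set may come last. *)
Lemma ordered_chain_nonref v : D v -> v \notin codom s ->
  ordered_chain L D s Ne (rcons ref_tail v).
Proof.
move=> Dv vs; apply/ordered_chain_rcons; split; first exact: ordered_chain_ref.
split=> //; rewrite -codom_ref// => l _; exact: codom_f.
Qed.

(* With [V] containing the whole reference set, no coordinate is left to
   integrate out in [fd_pdf]. *)
Lemma fd_pdf_chain (t : seq 'rV[R]_p) z : {in t, forall v, v \notin codom s} ->
  fd_pdf mu X s Ne w f p1 (codom s ++ t) z =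
  (chain_pdf s Ne w f p1 (ref_tail ++ t) z)%:E.
Proof.
move=> ts; rewrite /fd_pdf.
have -> : [seq v <- codom s | v \notin codom s ++ t] = [::].
  rewrite -[RHS](filter_pred0 (codom s)); apply: eq_in_filter => v vs.
  by rewrite mem_cat vs.
rewrite /= filter_cat.
have -> : [seq v <- codom s | v \notin codom s] = [::].
  rewrite -[RHS](filter_pred0 (codom s)); apply: eq_in_filter => v vs.
  by rewrite vs.
have -> : [seq v <- t | v \notin codom s] = t by apply/all_filterP/allP.
rewrite /= ref_pdf_chain /nonref_pdf mulrC /chain_pdf big_cat /=.
by rewrite mulrA.
Qed.

(** The finite-dimensional law at a list containing the whole reference set is applied to the
    cylinder over coordinate [a]; [t] carries the locations outside the reference set. *)
Lemma nnmp_marginal_law (t : seq 'rV[R]_p) a (A : set R) :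
  uniq t -> {in t, forall v, D v /\ v \notin codom s} ->
  a \in codom s ++ t -> measurable A ->
  P (Z a @^-1` A) =
  integrate_out mu X (s ord0 :: ref_tail ++ t)
    (fun z => (\1_A (z a))%:E * (chain_pdf s Ne w f p1 (ref_tail ++ t) z)%:E)%E
    (fun=> 0).
Proof.
move=> ut ht aV mA; set V := in_tuple (codom s ++ t).
have us : uniq (codom s) by apply/injectiveP; exact: (nnmp_ref_inj hZ).
have uV : uniq V.
  rewrite cat_uniq us ut andbT /=; apply/hasPn => v /ht[]//.
have DV j : D (tnth V j).
  have := mem_tnth j V; rewrite mem_cat => /orP[/codomP[i ->]|/ht[]//].
  exact: (nnmp_ref_dom hZ).
have /tnthP[j aj] : a \in V by [].
have mB : measurable ((tnth (T:=R))^~ j @^-1` A).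
  by rewrite -[X in measurable X]setTI; exact: measurable_tnth.
have := nnmp_fdd hZ uV DV mB.
have -> : [set o | ((tnth (T:=R))^~ j @^-1` A) [tuple Z (tnth V i) o | i < _]] =
    Z a @^-1` A.
  by apply/seteqP; split=> o /=; rewrite tnth_mktuple -aj.
rewrite -cat_cons -codom_ref => ->.
apply: eq_integrate_out => z _.
rewrite fd_pdf_chain => [|v /ht[]//]; congr (_ * _)%E.
rewrite !indicE; set b := _ \in _; suff -> : b = (z a \in A) by [].
by apply/idP/idP => /set_mem h; apply/mem_set; move: h;
  rewrite /= tnth_mktuple -aj.
Qed.

End ReferenceChain.

(** * Stationarity of every marginal *)

Theorem proposition1
  (R : realType)
  (mu : {sigma_finite_measure set R -> \bar R})
  (X : set R) (mX : measurable X)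
  (p n L : nat) (hp : (0 < p)%N) (hL : (0 < L <= n.+1)%N)
  (D : set 'rV[R]_p)
  (s : 'I_n.+1 -> 'rV[R]_p)
  (Ne : 'rV[R]_p -> seq 'I_n.+1)
  (w : 'rV[R]_p -> 'I_L -> R)
  (f : 'rV[R]_p -> 'I_L -> R -> R -> R)
  (p1 : R -> R)
  (d : measure_display) (T : measurableType d) (P : probability T R)
  (Z : 'rV[R]_p -> {RV P >-> R})
  (hZ : is_nnmp mu X D s Ne w f p1 Z)
  (dO : 'rV[R]_p -> 'I_L -> measure_display)
  (O : forall (v : 'rV[R]_p) (l : 'I_L), measurableType (dO v l))
  (Q : forall (v : 'rV[R]_p) (l : 'I_L), probability (O v l) R)
  (U V : forall (v : 'rV[R]_p) (l : 'I_L), {RV (Q v l) >-> R})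
  (fU fV : 'rV[R]_p -> 'I_L -> R -> R)
  (hU : forall v l, D v -> has_pdf mu X (U v l) (fU v l))
  (hV : forall v l, D v -> has_pdf mu X (V v l) (fV v l))
  (hUV : forall v l, D v -> has_cond_pdf mu X (U v l) (V v l) (fV v l) (f v l))
  (fZ : R -> R) (hfZ : is_pdf mu X fZ)
  (hZ1 : has_pdf mu X (Z (s ord0)) fZ)
  (hmarg : forall v l z, D v -> X z -> fZ z = fU v l z /\ fZ z = fV v l z) :
  forall v, D v -> has_pdf mu X (Z v) fZ.
Proof.
have w0 := nnmp_weight_ge0 hZ; have w1 := nnmp_weight_sum hZ.
have p1_pdf := nnmp_init hZ.
have hf v l : D v -> is_cond_pdf mu X (f v l) by case/(hUV v l).
have mI (A : set R) : measurable A -> measurable_fun X (fun x => (\1_A x)%:E).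
  by move=> mA; apply/measurable_EFinP; exact: measurable_indic.
(* Leaving [V] unrestricted in the joint law recovers the law of [U]; then [fU] and [fV] are both
   replaced by [fZ]. *)
have f_stat v l : D v -> forall A, measurable A ->
    (\int[mu]_(y in X) \int[mu]_(u in A `&` X) (f v l u y * fZ y)%:E =
     \int[mu]_(u in A `&` X) (fZ u)%:E)%E.
  move=> Dv A mA; have [_ hUA] := hU v l Dv; have [_ /(_ A setT mA)] := hUV v l Dv.
  rewrite preimage_setT setIT setTI hUA// => /(_ measurableT) E.
  transitivity (\int[mu]_(u in A `&` X) (fU v l u)%:E)%E.
    rewrite E; apply: eq_integral => y /set_mem Xy.
    by apply: eq_integral => u _; rewrite (hmarg v l y Dv Xy).2.
  by apply: eq_integral => u /set_mem[_ Xu]; rewrite (hmarg v l u Dv Xu).1.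
have ref_chain := ordered_chain_ref hZ.
(* The law of the first location is computed in two ways: it has density [fZ] by assumption, and
   integrating out the other reference locations gives [p1]. *)
have init_stat (H : R -> \bar R) : measurable_fun X H ->
    (\int[mu]_(t in X) (H t * (p1 t)%:E) = \int[mu]_(t in X) (H t * (fZ t)%:E))%E.
  have mp1 : measurable_fun X (EFin \o p1) by apply/measurable_EFinP; case: p1_pdf.
  move=> mH; apply/esym/(eq_integral_pdf mX hfZ mp1) => // E mE EX.
  have s0 : s ord0 \in codom s ++ [::] by rewrite cats0 codom_f.
  have := hZ1.2 E mE.
  rewrite (nnmp_marginal_law hZ (t := [::]) (a := s ord0))//.
  rewrite cats0 (integrate_out_chain_init mX w0 w1 hf p1_pdf
    (fun=> 0) (H := fun x => (\1_E x)%:E))//.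
  - by rewrite integral_indicM (setIidl EX).
  - exact: mI.
move=> v Dv; split=> // A mA.
(* For a reference location the chain is the reference set itself, with [t] empty; any other
   location is appended at its end. *)
have [vs|vs] := boolP (v \in codom s).
  rewrite (nnmp_marginal_law hZ (t := [::]) (a := v))//; last by rewrite cats0.
  rewrite cats0 (integrate_out_chain_stationary mX w0 w1 hf p1_pdf hfZ
    f_stat init_stat (fun=> 0) (H := fun x => (\1_A x)%:E))//.
  - exact: integral_indicM.
  - by rewrite -codom_ref.
  - exact: mI.
rewrite (nnmp_marginal_law hZ (t := [:: v]) (a := v))//; last 2 first.
- by move=> u; rewrite inE => /eqP ->.
- by rewrite mem_cat mem_head orbT.
rewrite cats1 (integrate_out_chain_stationary mX w0 w1 hf p1_pdf hfZ
    f_stat init_stat (fun=> 0) (H := fun x => (\1_A x)%:E))//.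
- exact: integral_indicM.
- exact: (ordered_chain_nonref hZ).
- by rewrite inE mem_rcons mem_head orbT.
- exact: mI.
Qed.
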